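(* Let $X, Y$ be topological spaces, let $f : X \to Y$ be a function, and let $p \in X$ be a point. Then the following are equivalent. (1) $f$ is multi-split continuous at $p$. (2) There exists a finite non-empty set $Z_p \subseteq Y$ such that the following two conditions hold: (a') for every $y \in Z_p$ there exists a net $\langle x_\lambda \rangle_{\lambda \in \Lambda}$ in $X$ converging to $p$ such that the net $\langle f(x_\lambda) \rangle_{\lambda \in \Lambda}$ converges to $y$ in $Y$; (b') for every net $\langle x_\lambda \rangle_{\lambda \in \Lambda}$ in $X$ converging to $p$ there exists some $y \in Z_p$ which is a cluster point of the net $\langle f(x_\lambda) \rangle_{\lambda \in \Lambda}$ in $Y$.
   Context: A neighborhood of a point $p$ (respectively of a subset $S$) in a topological space is a set $V$, not necessarily open, for which there is an open set $U$ with $p \in U \subseteq V$ (respectively $S \subseteq U \subseteq V$). Let $f : X \to Y$ be a function between topological spaces and $p \in X$. The function $f$ is multi-split continuous at $p$ if there exists a finite non-empty set $Z_p \subseteq Y$ such that: (a) for every $y \in Z_p$ and all neighborhoods $U \subseteq X$ of $p$ and $V \subseteq Y$ of $y$ one has $f(U) \cap V \neq \varnothing$; (b) for every neighborhood $V \subseteq Y$ of the set $Z_p$ there exists a neighborhood $U \subseteq X$ of $p$ with $f(U) \subseteq V$. Nets are indexed by (non-empty) sets $\Lambda$ with an upward directed preorder $\preccurlyeq$. A point $q$ is a cluster point of a net $\langle z_\lambda \rangle_{\lambda \in \Lambda}$ if for every neighborhood $W$ of $q$ and every $\lambda_0 \in \Lambda$ there is $\lambda_1 \in \Lambda$ with $\lambda_0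 \preccurlyeq \lambda_1$ and $z_{\lambda_1} \in W$. *)

(* Defs.v *)
From mathcomp Require Import all_boot all_order.
From mathcomp Require Import all_classical.
From mathcomp Require Import topology.

Set Implicit Arguments.
Unset Strict Implicit.
Unset Printing Implicit Defensive.

Local Open Scope classical_set_scope.

(* [set_nbhs Z] is the set of neighborhoods of the set [Z]: [set_nbhsP] states
   that [V] belongs to it iff [Z `<=` C `<=` V] for some open [C]. *)
Definition multi_split_continuous_at (X Y : topologicalType) (f : X -> Y)
    (p : X) : Prop :=
  exists Z : set Y,
    [/\ finite_set Z, Z !=set0,
        forall y, Z y -> forall (U : set X) (V : set Y),
          nbhs p U -> nbhs y V -> f @` U `&` V !=set0
      & forall V : set Y, set_nbhs Z V ->
          exists2 U : set X, nbhs p U & f @` U `<=` V].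

Record directedSet := DirectedSet {
  dir_sort :> Type;
  dir_le : dir_sort -> dir_sort -> Prop;
  dir_inhabited : inhabited dir_sort;
  dir_refl : forall l, dir_le l l;
  dir_trans : forall l1 l2 l3, dir_le l1 l2 -> dir_le l2 l3 -> dir_le l1 l3;
  dir_upward : forall l1 l2, exists2 l3, dir_le l1 l3 & dir_le l2 l3
}.

Definition net_cvg (T : topologicalType) (L : directedSet) (z : L -> T)
    (q : T) : Prop :=
  forall W : set T, nbhs q W ->
    exists l0 : L, forall l : L, dir_le l0 l -> W (z l).

Definition net_cluster (T : topologicalType) (L : directedSet) (z : L -> T)
    (q : T) : Prop :=
  forall W : set T, nbhs q W ->
    forall l0 : L, exists2 l1 : L, dir_le l0 l1 & W (z l1).

(* Main.v *)
Require Import Defs.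
From mathcomp Require Import all_boot all_order.
From mathcomp Require Import all_classical.
From mathcomp Require Import topology.

(** Nets and filters carry the same information.  The tails of a net generate
    a filter, and conversely every proper filter [F] is the filter of tails of
    a net, namely that of all pointed members [(A, a)], [a \in A \in F],
    ordered by reverse inclusion of the sets.  Each implication is then a
    statement about one well-chosen filter.

    - That images of neighborhoods of [p] meet all neighborhoods of [y] says
      that the sets [U `&` f @^-1` V], with [U] a neighborhood of [p] and [V]
      one of [y], generate a proper filter.  Its net converges to [p] and the
      image of that net converges to [y] ([meets_net]).  The converse holds
      because two tails of a net always meet.
    - If no neighborhood of [p] is mapped into a given neighborhood [V] of [Z],
      the trace of [nbhs p] on the complement of [f @^-1` V] is a proper
      filter; its net converges to [p] while its image avoids [V], hence
      clusters at no point of [Z] ([net_cluster_set_nbhs]).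
    - If the image of a net clusters at no point of [Z], each [y] in [Z] has a
      neighborhood [W y] that the image eventually avoids.  As [Z] is finite,
      the image eventually avoids the union of the [W y], a neighborhood of
      [Z].  Some neighborhood of [p] is mapped into that union, so the net
      cannot converge to [p] ([set_nbhs_net_cluster]). *)

Local Open Scope classical_set_scope.

Definition net_tails {T : Type} {L : directedSet} (z : L -> T) : set_system T :=
  [set A | exists l0 : L, forall l : L, dir_le l0 l -> A (z l)].

Lemma net_tails_proper {T : Type} {L : directedSet} (z : L -> T) :
  ProperFilter (net_tails z).
Proof.
split; first by case=> l0 /(_ l0 (dir_refl l0)).
split.
- by have [l0] := dir_inhabited L; exists l0.
- move=> A B [l1 Al1] [l2 Bl2].
  have [l3 l13 l23] := dir_upward l1 l2.
  exists l3 => l l3l; split.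
    by apply: Al1; exact: dir_trans l3l.
  by apply: Bl2; exact: dir_trans l3l.
- by move=> A B AB [l0 Al0]; exists l0 => l /Al0 /AB.
Qed.

(** A non-cluster point is seen by the filter of tails, which turns avoidance
    into something finite intersections preserve. *)
Lemma not_net_cluster {T : topologicalType} {L : directedSet} {z : L -> T}
    {q : T} :
  ~ net_cluster z q -> exists2 W, nbhs q W & net_tails z (~` W).
Proof.
move=> ncl; apply: contrapT => nW; apply: ncl => W qW l0.
apply: contrapT => nl1; apply: nW; exists W => //.
by exists l0 => l l0l Wzl; apply: nl1; exists l.
Qed.

Section FilterNet.
Context {T : Type} {F : set_system T} (FF : ProperFilter F).

(** A member of the filter together with one of its points: keeping the point
    in the index makes the net a projection, so that no choice is involved. *)
Definition pointed_member := {At : set T * T | F At.1 /\ At.1 At.2}.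

Definition pointed_member_le (i j : pointed_member) : Prop :=
  (sval j).1 `<=` (sval i).1.

Lemma pointed_member_inhabited : inhabited pointed_member.
Proof.
have [t _] := filter_ex (filterT : F setT).
by exists; exists (setT, t); split=> //; exact: filterT.
Qed.

Lemma pointed_member_le_refl i : pointed_member_le i i.
Proof. by []. Qed.

Lemma pointed_member_le_trans i j k :
  pointed_member_le i j -> pointed_member_le j k -> pointed_member_le i k.
Proof. by move=> ij jk; exact: subset_trans ij. Qed.

Lemma pointed_member_upward i j :
  exists2 k, pointed_member_le i k & pointed_member_le j k.
Proof.
case: i j => -[A a] [/= FA Aa] [[B b] [/= FB Bb]].
have FAB : F (A `&` B) by exact: filterI.
have [c ABc] := filter_ex FAB.
by exists (exist _ (A `&` B, c) (conj FAB ABc)) => t [].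
Qed.

Definition filter_directedSet := DirectedSet pointed_member_inhabited
  pointed_member_le_refl pointed_member_le_trans pointed_member_upward.

Definition filter_net (i : filter_directedSet) : T := (sval i).2.

(** The index [(A, a)] witnesses that the net is eventually in [A]: every later
    index carries a point of a subset of [A]. *)
Lemma filter_net_tails {A : set T} : F A -> net_tails filter_net A.
Proof.
move=> FA; have [a Aa] := filter_ex FA.
exists (exist _ (A, a) (conj FA Aa)) => j; apply; exact: (svalP j).2.
Qed.

End FilterNet.

(** Pairing neighborhoods of [p] with neighborhoods of [y] makes a single net
    control both limits: shrinking [U] drives the points to [p] and shrinking
    [V] drives their images to [y]. *)
Lemma meets_net {X Y : topologicalType} {f : X -> Y} {p : X} {y : Y} :
  (forall (U : set X) (V : set Y),
    nbhs p U -> nbhs y V -> f @` U `&` V !=set0) <->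
  exists (L : directedSet) (x : L -> X),
    net_cvg x p /\ net_cvg (fun l => f (x l)) y.
Proof.
split=> [meet|[L [x [xp fxy]]] U V pU yV]; last first.
  have xL : ProperFilter (net_tails x) := net_tails_proper x.
  have xV : net_tails x (f @^-1` V) := fxy V yV.
  have [t [Ut Vft]] := filter_ex (filterI (xp U pU : net_tails x U) xV).
  by exists (f t); split=> //; exists t.
pose D : set (set X * set Y) := [set UV | nbhs p UV.1 /\ nbhs y UV.2].
pose B (UV : set X * set Y) := UV.1 `&` f @^-1` UV.2.
have FF : ProperFilter (filter_from D B).
  apply: filter_from_proper.
    apply: filter_from_filter.
      by exists (setT, setT); split; exact: filterT.
    move=> [U1 V1] [U2 V2] [/= pU1 yV1] [/= pU2 yV2].
    exists (U1 `&` U2, V1 `&` V2); first by split; exact: filterI.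
    by move=> t [[/= ? ?] [? ?]].
  move=> [U V] [/= pU yV].
  by have [_ [[t Ut <-] Vft]] := meet U V pU yV; exists t.
exists (filter_directedSet FF), (filter_net FF); split.
  move=> U pU; apply: (filter_net_tails FF).
  by exists (U, setT) => [|t []//]; split => //; exact: filterT.
move=> V yV; apply: (filter_net_tails FF (A := f @^-1` V)).
by exists (setT, V) => [|t []//]; split => //; exact: filterT.
Qed.

Lemma set_nbhs_bigcup {Y : topologicalType} {Z : set Y} {W : Y -> set Y} :
  (forall y, Z y -> nbhs y (W y)) -> set_nbhs Z (\bigcup_(y in Z) W y).
Proof. by move=> ZW y Zy; apply: filterS (ZW y Zy) => t Wt; exists y. Qed.

(** Finiteness of [Z] is what allows the separate avoidances, one for each
    point of [Z], to hold simultaneously on a common tail. *)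
Lemma set_nbhs_net_cluster {X Y : topologicalType} {f : X -> Y} {p : X}
    {Z : set Y} : finite_set Z ->
  (forall V : set Y, set_nbhs Z V ->
    exists2 U : set X, nbhs p U & f @` U `<=` V) ->
  forall (L : directedSet) (x : L -> X), net_cvg x p ->
    exists2 y, Z y & net_cluster (fun l => f (x l)) y.
Proof.
move=> Zfin ctn L x xp; apply: contrapT => ncl.
have fxL := net_tails_proper (fun l => f (x l)).
have avoid y : exists W, Z y ->
    nbhs y W /\ net_tails (fun l => f (x l)) (~` W).
  have [Zy|nZy] := pselect (Z y); last by exists setT.
  have ny : ~ net_cluster (fun l => f (x l)) y.
    by move=> cl; apply: ncl; exists y.
  by have [W yW nW] := not_net_cluster ny; exists W.
have [W ZW] := choice avoid.
have fxW : net_tails (fun l => f (x l)) (\bigcap_(y in Z) ~` W y).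
  move: Zfin ZW => /finite_fsetP[s ->] ZW.
  by apply: filter_bigI => y ys; have [] := ZW y ys.
have [U pU fUW] := ctn _ (set_nbhs_bigcup (fun y Zy => (ZW y Zy).1)).
have fxU : net_tails (fun l => f (x l)) (f @` U).
  by have [l0 xU] := xp U pU; exists l0 => l /xU; exists (x l).
have [t [/fUW[y Zy Wyt] /(_ y Zy)]] := filter_ex (filterI fxU fxW).
exact.
Qed.

(** A neighborhood of [Z] is one of each point of [Z], so a net whose image
    stays outside [V] can cluster nowhere in [Z]. *)
Lemma net_cluster_set_nbhs {X Y : topologicalType} {f : X -> Y} {p : X}
    {Z : set Y} :
  (forall (L : directedSet) (x : L -> X), net_cvg x p ->
    exists2 y, Z y & net_cluster (fun l => f (x l)) y) ->
  forall V : set Y, set_nbhs Z V ->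
    exists2 U : set X, nbhs p U & f @` U `<=` V.
Proof.
move=> cl V ZV; apply: contrapT => nU.
pose N := ~` (f @^-1` V).
have FF : ProperFilter (within N (nbhs p)).
  split; last exact: within_filter.
  (* if [N] had empty trace, its complement would serve as [U] *)
  move=> pN; have {}pN : \forall t \near p, N t -> set0 t := pN.
  apply: nU; exists (f @^-1` V); last by move=> _ [t Vft <-].
  by apply: filterS pN => t nNt; exact: contrapT.
pose x := filter_net FF.
have xp : net_cvg x p.
  by move=> U pU; apply: (filter_net_tails FF); exact: cvg_within pU.
have [l0 xN] : net_tails x N.
  by apply: (filter_net_tails FF); exact: withinT.
have [y Zy yx] := cl _ x xp.
by have [l l0l Vfx] := yx V (ZV y Zy) l0; exact: (xN l l0l).
Qed.

Theorem proposition3p8 (X Y : topologicalType) (f : X -> Y) (p : X) :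
  multi_split_continuous_at f p <->
  exists Z : set Y,
    [/\ finite_set Z, Z !=set0,
        forall y, Z y ->
          exists (L : directedSet) (x : L -> X),
            net_cvg x p /\ net_cvg (fun l => f (x l)) y
      & forall (L : directedSet) (x : L -> X), net_cvg x p ->
          exists2 y, Z y & net_cluster (fun l => f (x l)) y].
Proof.
split=> -[Z [Zfin Z0 Za Zb]]; exists Z; split=> //.
- by move=> y /Za /meets_net.
- exact: set_nbhs_net_cluster Zb.
- by move=> y /Za /meets_net.
- exact: net_cluster_set_nbhs Zb.
Qed.
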